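(* Let $n\ge 1$ and let $\{\omega^0,\omega^1,\ldots,\omega^{2n-1}\}$ be a fixed basis of $\mathbb{C}^{2n}$. (1) For a complex skew-symmetric matrix $M=(M_{AB})\in M_{\mathbb{C}}(2n,2n)$, the $2$-form $$\omega=\sum_{A,B=0}^{2n-1}M_{AB}\,\omega^A\wedge\omega^B \in\wedge^2\mathbb{C}^{2n}$$ is real if and only if there exists a hyperhermitian quaternionic $n\times n$-matrix $\mathcal{M}$ such that $$M=\tau(\mathcal{M})J.$$ (2) When $\omega=\sum_{A,B=0}^{2n-1}M_{AB}\,\omega^A\wedge\omega^B$ (with $M$ complex skew-symmetric) is real, there exists a quaternionic unitary matrix $\mathcal{E}\in \mathrm{U}_{\mathbb{H}}(n)$ such that $$\tau(\mathcal{E})^tM\tau(\mathcal{E})=\begin{pmatrix}0&\mathrm{diag}(\nu_0,\ldots,\nu_{n-1})\\ -\mathrm{diag}(\nu_0,\ldots,\nu_{n-1})&0\end{pmatrix}$$ for some real numbers $\nu_0,\ldots,\nu_{n-1}$. Namely, we can normalize $\omega$ as $$\omega=2\sum_{l=0}^{n-1}\nu_l\,\widetilde{\omega}^l\wedge\widetilde{\omega}^{l+n}\qquad\text{with}\qquad \widetilde{\omega}^A=\mathcal{E}^*.\omega^A .$$ In particular, $\omega$ is strongly positive if and only if $\nu_l\ge 0$ for $l=0,\ldots,n-1$ and at least one $\nu_l$ is positive.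
   Context: $M_{\mathbb{F}}(p,m)$ is the space of $p\times m$ matrices over $\mathbb{F}=\mathbb{R},\mathbb{C},\mathbb{H}$; $\mathbb{C}\subset\mathbb{H}$ via $\mathbf{i}$, and $\mathbb{H}$ has the standard units $\mathbf{i},\mathbf{j},\mathbf{k}$. For $\mathcal{M}\in M_{\mathbb{H}}(p,m)$, $\mathcal{M}^*=\overline{\mathcal{M}}^t$ (quaternionic conjugate transpose); a square matrix $\mathcal{M}=(\mathcal{M}_{jk})$ is hyperhermitian if $\mathcal{M}_{jk}=\overline{\mathcal{M}_{kj}}$. $\mathrm{U}_{\mathbb{H}}(n)$ is the set of invertible $\mathcal{M}\in M_{\mathbb{H}}(n,n)$ with $\mathcal{M}^*\mathcal{M}=\mathcal{M}\mathcal{M}^*=I_n$. Embedding $\tau:M_{\mathbb{H}}(p,m)\to M_{\mathbb{C}}(2p,2m)$: write $\mathcal{M}=a+b\mathbf{j}$ with $a,b\in M_{\mathbb{C}}(p,m)$ and put $$\tau(\mathcal{M})=\begin{pmatrix}a&-b\\ \overline{b}&\overline{a}\end{pmatrix}.$$ Let $J=\begin{pmatrix}0&I_n\\-I_n&0\end{pmatrix}$. Actions: $M\in M_{\mathbb{C}}(2n,2n)$ acts $\mathbb{C}$-linearly on $\mathbb{C}^{2n}$ by $M.\omega^A=\sum_{B=0}^{2n-1}M_{AB}\,\omega^B$, and $\mathcal{M}\in M_{\mathbb{H}}(n,n)$ acts by $\mathcal{M}.\omega^A=\tau(\mathcal{M}).\omega^A$; both are extended to the exterior powers by acting on each factor.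 Real forms: $\rho(\mathbf{j}):\mathbb{C}^{2n}\to\mathbb{C}^{2n}$ is the real linear (anti-complex-linear) map $\rho(\mathbf{j})(z\omega^k)=\overline{z}\,J.\omega^k$ ($z\in\mathbb{C}$), extended to $\wedge^{2k}\mathbb{C}^{2n}$ by acting on each factor and conjugating coefficients. An element $\varphi\in\wedge^{2k}\mathbb{C}^{2n}$ is real if $\rho(\mathbf{j})\varphi=\varphi$; the real elements form the space $\wedge^{2k}_{\mathbb{R}}\mathbb{C}^{2n}$. Strong positivity (for $2$-forms): a right $\mathbb{H}$-linear map $\eta:\mathbb{H}^n\to\mathbb{H}$, $\eta(q)=\sum_l \mathcal{N}_l q_l$ with $\mathcal{N}=(\mathcal{N}_l)\in M_{\mathbb{H}}(1,n)$, induces $\eta^*:\mathbb{C}^2\to\mathbb{C}^{2n}$ by $\eta^*\widehat{\omega}^p=\sum_{j=0}^{2n-1}\tau(\mathcal{N})_{pj}\,\omega^j$, $p=0,1$, where $\{\widehat\omega^0,\widehat\omega^1\}$ is a basis of $\mathbb{C}^2$. An element of $\wedge^2_{\mathbb{R}}\mathbb{C}^{2n}$ is elementary strongly positive if it equals $\eta^*\widehat{\omega}^0\wedge\eta^*\widehat{\omega}^1$ for some nonzero right $\mathbb{H}$-linear $\eta:\mathbb{H}^n\to\mathbb{H}$. An element of $\wedge^2_{\mathbb{R}}\mathbb{C}^{2n}$ is strongly positive if it belongs to the convex cone generated by the elementary strongly positive elements, i.e. it is a finite nonempty sum of elementary strongly positive elements with positive coefficients (so $0$ is not counted as strongly positive).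 *)

(* Defs.v *)
From HB Require Import structures.
From mathcomp Require Import all_boot all_order all_algebra.
From mathcomp Require Import reals.
From mathcomp.real_closed Require Import complex.
From mathcomp Require Import ring.

Set Implicit Arguments.
Unset Strict Implicit.
Unset Printing Implicit Defensive.

Import Order.TTheory GRing.Theory Num.Theory.

Local Open Scope ring_scope.
Local Open Scope complex_scope.

(* Quat x0 x1 x2 x3 is x0 + x1 i + x2 j + x3 k. *)
Record quat (R : Type) : Type := Quat { q0 : R; q1 : R; q2 : R; q3 : R }.

Section QuatChoice.
Variable R : Type.

Definition tuple_of_quat (q : quat R) : R * R * R * R :=
  (q0 q, q1 q, q2 q, q3 q).

Definition quat_of_tuple (t : R * R * R * R) : quat R :=
  let: (a, b, c, d) := t in Quat a b c d.

Lemma tuple_of_quatK : cancel tuple_of_quat quat_of_tuple.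
Proof. by case. Qed.

End QuatChoice.

HB.instance Definition _ (R : eqType) :=
  Equality.copy (quat R) (can_type (@tuple_of_quatK R)).
HB.instance Definition _ (R : choiceType) :=
  Choice.copy (quat R) (can_type (@tuple_of_quatK R)).

Section QuatRing.
Variable R : comNzRingType.
Implicit Types p q r : quat R.

Definition zeroq : quat R := Quat 0 0 0 0.
Definition oneq : quat R := Quat 1 0 0 0.
Definition oppq q : quat R := Quat (- q0 q) (- q1 q) (- q2 q) (- q3 q).
Definition addq p q : quat R :=
  Quat (q0 p + q0 q) (q1 p + q1 q) (q2 p + q2 q) (q3 p + q3 q).
Definition mulq p q : quat R :=
  Quat (q0 p * q0 q - q1 p * q1 q - q2 p * q2 q - q3 p * q3 q)
       (q0 p * q1 q + q1 p * q0 q + q2 p * q3 q - q3 p * q2 q)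
       (q0 p * q2 q - q1 p * q3 q + q2 p * q0 q + q3 p * q1 q)
       (q0 p * q3 q + q1 p * q2 q - q2 p * q1 q + q3 p * q0 q).

Lemma addqA : associative addq.
Proof. by move=> [? ? ? ?] [? ? ? ?] [? ? ? ?]; rewrite /addq /= !addrA. Qed.
Lemma addqC : commutative addq.
Proof.
by move=> [a b c d] [e f g h]; congr Quat => /=; rewrite addrC.
Qed.
Lemma add0q : left_id zeroq addq.
Proof. by move=> [? ? ? ?]; rewrite /addq /= !add0r. Qed.
Lemma addNq : left_inverse zeroq oppq addq.
Proof. by move=> [? ? ? ?]; rewrite /addq /= !addNr. Qed.

HB.instance Definition _ :=
  GRing.isZmodule.Build (quat R) addqA addqC add0q addNq.

Lemma mulqA : associative mulq.
Proof.
by move=> [? ? ? ?] [? ? ? ?] [? ? ? ?]; congr Quat => /=; ring.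
Qed.
Lemma mul1q : left_id oneq mulq.
Proof. by move=> [? ? ? ?]; congr Quat => /=; ring. Qed.
Lemma mulq1 : right_id oneq mulq.
Proof. by move=> [? ? ? ?]; congr Quat => /=; ring. Qed.
Lemma mulqDl : left_distributive mulq addq.
Proof.
by move=> [? ? ? ?] [? ? ? ?] [? ? ? ?]; congr Quat => /=; ring.
Qed.
Lemma mulqDr : right_distributive mulq addq.
Proof.
by move=> [? ? ? ?] [? ? ? ?] [? ? ? ?]; congr Quat => /=; ring.
Qed.
Lemma oneq_neq0 : oneq != zeroq.
Proof. by apply/eqP => -[] /eqP; rewrite oner_eq0. Qed.

HB.instance Definition _ := GRing.Zmodule_isNzRing.Build (quat R)
  mulqA mul1q mulq1 mulqDl mulqDr oneq_neq0.

Definition conjq q : quat R := Quat (q0 q) (- q1 q) (- q2 q) (- q3 q).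

Definition quat_i : quat R := Quat 0 1 0 0.
Definition quat_j : quat R := Quat 0 0 1 0.
Definition quat_k : quat R := Quat 0 0 0 1.

Definition complex_quat (z : R[i]) : quat R := Quat (complex.Re z) (complex.Im z) 0 0.

(* The complex components in q = a + b j. *)
Definition quat_a q : R[i] := q0 q +i* q1 q.
Definition quat_b q : R[i] := q2 q +i* q3 q.

Lemma quat_units :
  [/\ quat_i * quat_i = -1, quat_j * quat_j = -1, quat_k * quat_k = -1
    & quat_i * quat_j = quat_k].
Proof. by split; congr Quat => /=; ring. Qed.

Lemma quat_abE q :
  q = complex_quat (quat_a q) + complex_quat (quat_b q) * quat_j.
Proof. by case: q => a b c d; congr Quat => /=; ring. Qed.

End QuatRing.

Section QuatMatrix.
Variable R : rcfType.

Definition adjq p m (Q : 'M[quat R]_(p, m)) : 'M[quat R]_(m, p) :=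
  (map_mx (@conjq R) Q)^T.

Definition hyperhermitian n (Q : 'M[quat R]_n) : Prop :=
  forall j k : 'I_n, Q j k = conjq (Q k j).

(* The two equations exhibit adjq Q as the inverse of Q. *)
Definition unitaryq n (Q : 'M[quat R]_n) : Prop :=
  adjq Q *m Q = 1%:M /\ Q *m adjq Q = 1%:M.

Definition tau p m (Q : 'M[quat R]_(p, m)) : 'M[R[i]]_(p + p, m + m) :=
  let a := map_mx (@quat_a R) Q in
  let b := map_mx (@quat_b R) Q in
  block_mx a (- b) (map_mx conjc b) (map_mx conjc a).

Definition Jmx n : 'M[R[i]]_(n + n) := block_mx 0 1%:M (- 1%:M) 0.

End QuatMatrix.

Arguments Jmx R n : clear implicits.

(* The exterior algebra of 'rV[F]_N: the coordinate of an element at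
   S = {i_1 < ... < i_k} is its coefficient on e_(i_1) /\ ... /\ e_(i_k),
   where e_i = delta_mx 0 i. *)
Definition extalg (F : comNzRingType) (N : nat) : Type :=
  {ffun {set 'I_N} -> F^o}.
HB.instance Definition _ (F : comNzRingType) (N : nat) :=
  GRing.Lmodule.copy (extalg F N) {ffun {set 'I_N} -> F^o}.

Section Exterior.
Variables (F : comNzRingType) (N : nat).

Definition blade (S : {set 'I_N}) : extalg F N :=
  [ffun T => (T == S)%:R : F^o].

Definition invs (S T : {set 'I_N}) : nat :=
  #|[set x : 'I_N * 'I_N | [&& x.1 \in S, x.2 \in T & (x.2 < x.1)%N]]|.

(* blade S /\ blade T = (-1) ^ invs S T blade (S :|: T) for disjoint S, T,
   and 0 otherwise. *)
Definition wedge (phi psi : extalg F N) : extalg F N :=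
  [ffun S : {set 'I_N} =>
     \sum_(T in powerset S)
        (-1) ^+ invs T (S :\: T) * (phi T * psi (S :\: T)) : F^o].

Definition ext1 (v : 'rV[F]_N) : extalg F N :=
  \sum_i v 0 i *: blade [set i].

Definition extpow (k : nat) (phi : extalg F N) : Prop :=
  forall S : {set 'I_N}, #|S| != k -> phi S = 0.

(* For f semilinear over the ring endomorphism s, this is the s-semilinear map
   sending v_1 /\ ... /\ v_k to f v_1 /\ ... /\ f v_k. *)
Definition extmap (s : F -> F) (f : 'rV[F]_N -> 'rV[F]_N)
    (phi : extalg F N) : extalg F N :=
  \sum_(S : {set 'I_N}) s (phi S) *:
    \big[wedge/blade set0]_(i <- enum S) ext1 (f (delta_mx 0 i)).

End Exterior.

Section Forms.
Variables (R : realType) (n : nat).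
Local Notation C := R[i].
Local Notation V := 'rV[C]_(n + n).
Local Notation Lambda := (extalg C (n + n)).
(* The basis is w = (omega^0, ..., omega^(2n-1)). *)
Variable w : (n + n).-tuple V.

Definition act (M : 'M[C]_(n + n)) (v : V) : V :=
  \sum_A coord w A v *: \sum_B M A B *: tnth w B.

Definition actq (Q : 'M[quat R]_n) (v : V) : V := act (tau Q) v.

Definition rhoj (v : V) : V :=
  \sum_A conjc (coord w A v) *: act (Jmx R n) (tnth w A).

Definition ext_rhoj : Lambda -> Lambda := extmap conjc rhoj.

Definition real_form (k : nat) (phi : Lambda) : Prop :=
  extpow (2 * k) phi /\ ext_rhoj phi = phi.

Definition two_form (M : 'M[C]_(n + n)) : Lambda :=
  \sum_A \sum_B M A B *: wedge (ext1 (tnth w A)) (ext1 (tnth w B)).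

Definition right_linear (eta : 'cV[quat R]_n -> quat R) : Prop :=
  (forall q q', eta (q + q') = eta q + eta q') /\
  (forall (q : 'cV[quat R]_n) (c : quat R), eta (\col_l (q l 0 * c)) = eta q * c).

(* eta^* applied to the p-th basis vector of C^2, where eta is given by Nr. *)
Definition pull (Nr : 'rV[quat R]_n) (p : 'I_(1 + 1)) : V :=
  \sum_j tau Nr p j *: tnth w j.

Definition elem_strongly_positive (phi : Lambda) : Prop :=
  real_form 1 phi /\
  exists (eta : 'cV[quat R]_n -> quat R) (Nr : 'rV[quat R]_n),
    [/\ right_linear eta,
        forall q, eta q = \sum_l Nr 0 l * q l 0,
        exists q, eta q <> 0
      & phi = wedge (ext1 (pull Nr (lshift 1 ord0)))
                    (ext1 (pull Nr (rshift 1 ord0)))].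

Definition strongly_positive (phi : Lambda) : Prop :=
  real_form 1 phi /\
  exists (m : nat) (c : 'I_m.+1 -> R) (psi : 'I_m.+1 -> Lambda),
    [/\ forall i, 0 < c i,
        forall i, elem_strongly_positive (psi i)
      & phi = \sum_i (c i)%:C *: psi i].

Definition normal_mx (nu : 'rV[R]_n) : 'M[C]_(n + n) :=
  let D := diag_mx (map_mx (real_complex R) nu) in block_mx 0 D (- D) 0.

End Forms.

(* Main.v *)
From HB Require Import structures.
Require Import Defs.
From mathcomp Require Import all_boot all_order all_algebra.
From mathcomp Require Import reals.
From mathcomp.real_closed Require Import complex.
From mathcomp Require Import ring lra spectral.

(* In the basis w every 2-form is given by a skew matrix M, and M is unique.
   On matrices rho(j) reads M |-> J^T conj(M) J, and the matrices X with
   J X = conj(X) J are exactly those in the image of tau; hence the real forms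
   are the M = tau(Q) J with Q hyperhermitian, and equally the M = J tau(Q).
   Since tau(E)^T J = J tau(E^* ), a congruence of M = J tau(Q) by tau(E) turns
   Q into E^* Q E, so the normal form is the spectral theorem for hyperhermitian
   matrices. That theorem is proved by deflation: an eigenvector of the complex
   matrix tau(Q) yields a quaternionic one, which a Householder reflection
   moves to the first basis vector. Finally the elementary strongly positive
   form of a row N has matrix J tau(N^* N) / 2, so the nu_l of a positive
   combination of such forms are sums of c_i |(N_i E)_l|^2 / 2. *)

Set Implicit Arguments.
Unset Strict Implicit.
Unset Printing Implicit Defensive.

Import Order.TTheory GRing.Theory Num.Theory.

Local Open Scope ring_scope.
Local Open Scope complex_scope.

(** * Two-forms and skew matrices *)

Section ExteriorSquare.
Variables (F : comNzRingType) (N : nat).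
Implicit Types (X Y : 'M[F]_N) (S : {set 'I_N}) (phi : extalg F N).

Lemma ext_addE phi psi S : (phi + psi) S = phi S + psi S.
Proof. exact: ffunE. Qed.

Lemma ext_zeroE S : (0 : extalg F N) S = 0.
Proof. exact: ffunE. Qed.

Lemma ext_scaleE a phi S : (a *: phi) S = a * phi S.
Proof. exact: ffunE. Qed.

Lemma ext_sumE (I : Type) (r : seq I) (P : pred I) (f : I -> extalg F N) S :
  (\sum_(i <- r | P i) f i) S = \sum_(i <- r | P i) f i S.
Proof.
by apply: (big_morph (fun phi : extalg F N => phi S)) => [x y|];
  rewrite ?ext_addE ?ext_zeroE.
Qed.

Lemma wedge_lin (I J : finType) (a : I -> F) (b : J -> F)
    (f : I -> extalg F N) (g : J -> extalg F N) :
  wedge (\sum_i a i *: f i) (\sum_j b j *: g j) =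
  \sum_i \sum_j (a i * b j) *: wedge (f i) (g j).
Proof.
apply/ffunP => S; rewrite ffunE ext_sumE.
under [RHS]eq_bigr => i _.
  rewrite ext_sumE; under eq_bigr => j _ do rewrite ext_scaleE ffunE mulr_sumr.
  rewrite exchange_big /=; over.
rewrite exchange_big /=; apply: eq_bigr => T _.
rewrite !ext_sumE mulr_suml mulr_sumr; apply: eq_bigr => i _.
rewrite !mulr_sumr; apply: eq_bigr => j _; rewrite !ext_scaleE; ring.
Qed.

(** [extmap] folds wedge products starting from [blade set0], so this clears the end of the fold. *)
Lemma wedge_unitr phi : wedge phi (blade F set0) = phi.
Proof.
apply/ffunP => S; rewrite ffunE (bigD1 S) /=; last by rewrite powersetE.
rewrite big1 ?addr0 => [|T /andP[]]; last first.
  rewrite powersetE => sTS; rewrite ffunE setD_eq0 eqEsubset sTS /= => /negPf->.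
  by rewrite !mulr0.
rewrite setDv ffunE eqxx mulr1 /invs (_ : [set x | _] = set0) ?cards0 ?mul1r //.
by apply/setP => x; rewrite !inE andbF.
Qed.

Lemma wedge_blade1 (i j : 'I_N) :
  wedge (blade F [set i]) (blade F [set j]) =
  [ffun S : {set 'I_N} =>
     if (i != j) && (S == [set i; j]) then (-1) ^+ (j < i)%N else 0 : F^o].
Proof.
have invs1 : invs [set i] [set j] = (j < i)%N.
  rewrite /invs; case: (ltnP j i) => ij.
    rewrite (_ : [set x | _] = [set (i, j)]) ?cards1 //.
    apply/setP => -[a b]; rewrite !inE xpair_eqE.
    by case: eqP => //= ->; case: eqP => //= ->; rewrite ij.
  rewrite (_ : [set x | _] = set0) ?cards0 //; apply/setP => -[a b].
  by rewrite !inE; case: eqP => //= ->; case: eqP => //= ->; rewrite ltnNge ij.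
apply/ffunP => S; rewrite !ffunE.
case: ifP => [/andP[neij /eqP->]|ijS].
  have SD : [set i; j] :\: [set i] = [set j].
    by apply/setP => x; rewrite !inE; case: (eqVneq x i) => [->|]; rewrite ?(negPf neij).
  rewrite (bigD1 [set i]) /=; last by rewrite powersetE sub1set !inE eqxx.
  rewrite big1 ?addr0 => [|T /andP[_ /negPf neT]]; last first.
    by rewrite ffunE neT mul0r mulr0.
  by rewrite SD invs1 !ffunE !eqxx !mulr1.
rewrite big1 // => T; rewrite powersetE => sTS; rewrite !ffunE.
case: eqP => [Ti|_]; rewrite ?mul0r ?mulr0 //; case: eqP => [SDj|_]; rewrite ?mulr0 //.
case/negP: (negbT ijS); subst T; apply/andP; split.
  by have := set11 j; rewrite -SDj !inE => /andP[]; rewrite eq_sym.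
by rewrite -(setID S [set i]) SDj (setIidPr sTS).
Qed.

(** The 2-form of X in the standard basis. X is arbitrary: only X - X^T is visible in the result,
    which lets congruences be computed before any skewness is used. *)
Definition skewform X : extalg F N :=
  \sum_i \sum_j X i j *: wedge (blade F [set i]) (blade F [set j]).

Fact skewform_is_linear : linear skewform.
Proof.
move=> a X Y; rewrite /skewform scaler_sumr -big_split; apply: eq_bigr => i _.
rewrite scaler_sumr -big_split; apply: eq_bigr => j _ /=.
by rewrite !mxE scalerDl scalerA.
Qed.
HB.instance Definition _ :=
  GRing.isLinear.Build F 'M[F]_N (extalg F N) _ skewform skewform_is_linear.

Lemma skewform_pair X (a b : 'I_N) : (a < b)%N ->
  skewform X [set a; b] = X a b - X b a.
Proof.
move=> ab; have neab : a != b by rewrite -val_eqE /= ltn_eqF.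
rewrite /skewform pair_big /= ext_sumE (bigD1 (a, b)) //= (bigD1 (b, a)) /=; last first.
  by rewrite xpair_eqE negb_and eq_sym neab.
rewrite !ext_scaleE !wedge_blade1 !ffunE (setUC [set b]) eqxx (eq_sym b) neab /=.
rewrite ab ltnNge ltnW //= expr0 expr1 mulr1 mulrN1 big1 ?addr0 //.
move=> [i j] /andP[/=]; rewrite !xpair_eqE => ij_ab ij_ba.
rewrite ext_scaleE wedge_blade1 ffunE; case: ifP; rewrite ?mulr0 // => /andP[neij /eqP E].
have /set2P[Ei|Ei] : i \in [set a; b] by rewrite E set21.
  have /set2P[Ej|Ej] : j \in [set a; b] by rewrite E set22.
    by rewrite Ei Ej eqxx in neij.
  by rewrite Ei Ej !eqxx in ij_ab.
have /set2P[Ej|Ej] : j \in [set a; b] by rewrite E set22.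
  by rewrite Ei Ej !eqxx in ij_ba.
by rewrite Ei Ej eqxx in neij.
Qed.

Lemma skewform_extpow X : extpow 2 (skewform X).
Proof.
move=> S S2; rewrite ext_sumE big1 // => i _; rewrite ext_sumE big1 // => j _.
rewrite ext_scaleE wedge_blade1 ffunE; case: ifP; rewrite ?mulr0 //.
by case/andP => neij /eqP E; rewrite E cards2 neij in S2.
Qed.

(** A 2-form is determined by its coordinates at the pairs a < b, and these are the entries of X -
    X^T. Phrasing it so avoids halving, which a general ring does not allow. *)
Lemma skewform_eqP X Y : skewform X = skewform Y <-> X - X^T = Y - Y^T.
Proof.
split=> [XY | XY].
  apply/matrixP => i j; rewrite !mxE.
  case: (ltngtP i j) => [ij|ji|/val_inj->]; last by rewrite !subrr.
    by rewrite -!skewform_pair ?XY.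
  by rewrite -[LHS]opprB -[RHS]opprB -!skewform_pair ?XY.
apply/ffunP => S; case: (boolP (#|S| == 2%N)) => [S2|S2]; last by rewrite !skewform_extpow.
case/cards2P: S2 => a [b [neab ->]].
wlog ab : a b neab / (a < b)%N.
  move=> H; case: (ltngtP a b) => [||/val_inj eab]; first exact: H.
    by rewrite setUC; apply: H; rewrite eq_sym.
  by rewrite eab eqxx in neab.
by rewrite !skewform_pair //; move/matrixP/(_ a b): XY; rewrite !mxE.
Qed.

Lemma skewform_antisym X : skewform (X - X^T) = 2 *: skewform X.
Proof.
rewrite -linearZ; apply/skewform_eqP/matrixP => i j; rewrite !mxE; ring.
Qed.

Lemma wedge_ext1 (u v : 'rV[F]_N) : wedge (ext1 u) (ext1 v) = skewform (u^T *m v).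
Proof.
rewrite wedge_lin /skewform; apply: eq_bigr => i _; apply: eq_bigr => j _.
by rewrite !mxE big_ord1 !mxE.
Qed.

(** Change of basis: the vectors are the rows of P, so the standard matrix is a congruence of X by
    P. *)
Lemma sum_wedge_rows m (P : 'M[F]_(m, N)) (X : 'M[F]_m) :
  \sum_a \sum_b X a b *: wedge (ext1 (row a P)) (ext1 (row b P)) =
  skewform (P^T *m X *m P).
Proof.
under eq_bigr => a _ do under eq_bigr => b _ do rewrite wedge_ext1 -linearZ /=.
under eq_bigr => a _ do rewrite -linear_sum /=.
rewrite -linear_sum /=; congr skewform; apply/matrixP => i j.
rewrite summxE !mxE; under [RHS]eq_bigr => b _ do rewrite mxE mulr_suml.
rewrite exchange_big /=; apply: eq_bigr => a _; rewrite summxE.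
by apply: eq_bigr => b _; rewrite !mxE big_ord1 !mxE mulrCA mulrA.
Qed.

(** * Semilinear maps acting on 2-forms *)

Lemma extmapZ (s : {rmorphism F -> F}) f a phi :
  @extmap F N s f (a *: phi) = s a *: extmap s f phi.
Proof.
rewrite /extmap scaler_sumr; apply: eq_bigr => S _.
by rewrite ext_scaleE rmorphM scalerA.
Qed.

Lemma extmap_sum (s : {rmorphism F -> F}) f (I : Type) (r : seq I) (P : pred I)
    (g : I -> extalg F N) :
  extmap s f (\sum_(i <- r | P i) g i) = \sum_(i <- r | P i) extmap s f (g i).
Proof.
rewrite exchange_big /=; apply: eq_bigr => S _.
by rewrite ext_sumE rmorph_sum scaler_suml.
Qed.

Lemma enum_pair (i j : 'I_N) : (i < j)%N -> enum [set i; j] = [:: i; j].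
Proof.
move=> ij; apply: (@irr_sorted_eq _ (relpre val ltn)).
- by move=> x y z /=; apply: ltn_trans.
- by move=> x /=; rewrite ltnn.
- rewrite /enum_mem sorted_filter //; first by move=> x y z /=; apply: ltn_trans.
  by rewrite -sorted_map -enumT val_enum_ord iota_ltn_sorted.
- by rewrite /= ij.
by move=> x; rewrite mem_enum !inE.
Qed.

(** For i < j this unfolds the definition, whose fold follows the increasing enumeration. The case i
    > j reduces to it by anticommutativity, and for i = j both sides vanish. *)
Lemma extmap_wedge_blade1 (s : {rmorphism F -> F}) f (i j : 'I_N) :
  extmap s f (wedge (blade F [set i]) (blade F [set j])) =
  wedge (ext1 (f (delta_mx 0 i))) (ext1 (f (delta_mx 0 j))).
Proof.
have lt_case (a b : 'I_N) : (a < b)%N ->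
    extmap s f (wedge (blade F [set a]) (blade F [set b])) =
    wedge (ext1 (f (delta_mx 0 a))) (ext1 (f (delta_mx 0 b))).
  move=> ab; rewrite /extmap (bigD1 [set a; b]) //= big1 ?addr0 => [|S /negPf neS].
    rewrite enum_pair // !big_cons big_nil wedge_unitr wedge_blade1 ffunE eqxx andbT.
    by rewrite -val_eqE /= ltn_eqF // ltnNge ltnW //= rmorph1 scale1r.
  by rewrite wedge_blade1 ffunE neS andbF rmorph0 scale0r.
have anti (u v : 'rV[F]_N) : wedge (ext1 u) (ext1 v) = - wedge (ext1 v) (ext1 u).
  rewrite !wedge_ext1 -linearN; apply/skewform_eqP.
  by rewrite linearN /= !trmx_mul !trmxK opprK addrC.
have alt (u : 'rV[F]_N) : wedge (ext1 u) (ext1 u) = 0.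
  by rewrite wedge_ext1 -[RHS](linear0 skewform); apply/skewform_eqP;
     rewrite trmx_mul trmxK trmx0 !subrr.
have blade_ext1 (a : 'I_N) : blade F [set a] = ext1 (delta_mx 0 a).
  rewrite /ext1 (bigD1 a) //= big1 ?addr0 => [|b neb]; rewrite mxE !eqxx ?scale1r //.
  by rewrite (negPf neb) scale0r.
case: (ltngtP i j) => [/lt_case// | ji | /val_inj->].
  rewrite anti -lt_case // !blade_ext1 anti -scaleN1r.
  by rewrite extmapZ rmorphN1 scaleN1r.
by rewrite !blade_ext1 !alt /extmap big1 // => S _; rewrite ext_zeroE rmorph0 scale0r.
Qed.

Lemma extmap_skewform (s : {rmorphism F -> F}) f X :
  let P := \matrix_i f (delta_mx 0 i) in
  extmap s f (skewform X) = skewform (P^T *m map_mx s X *m P).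
Proof.
move=> P; rewrite /skewform extmap_sum -/(skewform _) -sum_wedge_rows.
apply: eq_bigr => i _; rewrite extmap_sum; apply: eq_bigr => j _.
by rewrite extmapZ extmap_wedge_blade1 mxE !rowK.
Qed.

End ExteriorSquare.

(** * Quaternions and the embedding tau *)

Section Quaternions.
Variable R : rcfType.
Implicit Types (p q : quat R) (r s : R).

Lemma quat_eqP p q :
  p = q <-> [/\ q0 p = q0 q, q1 p = q1 q, q2 p = q2 q & q3 p = q3 q].
Proof. by split=> [->//|]; case: p q => [? ? ? ?] [? ? ? ?] /= [-> -> -> ->]. Qed.

Fact quat_a_is_additive : zmod_morphism (@quat_a R).
Proof. by move=> [? ? ? ?] [? ? ? ?]. Qed.
HB.instance Definition _ :=
  GRing.isZmodMorphism.Build (quat R) R[i] (@quat_a R) quat_a_is_additive.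

Fact quat_b_is_additive : zmod_morphism (@quat_b R).
Proof. by move=> [? ? ? ?] [? ? ? ?]. Qed.
HB.instance Definition _ :=
  GRing.isZmodMorphism.Build (quat R) R[i] (@quat_b R) quat_b_is_additive.

Fact conjq_is_additive : zmod_morphism (@conjq R).
Proof. by move=> [? ? ? ?] [? ? ? ?]; apply/quat_eqP; split=> //=; rewrite opprD. Qed.
HB.instance Definition _ :=
  GRing.isZmodMorphism.Build (quat R) (quat R) (@conjq R) conjq_is_additive.

(** Expand (a + b j)(c + d j) with j z = conj(z) j and j^2 = -1; [quat_bM] is the other
    component. *)
Lemma quat_aM p q :
  quat_a (p * q) = quat_a p * quat_a q - quat_b p * conjc (quat_b q).
Proof.
by case: p q => [? ? ? ?] [? ? ? ?]; apply/eqP; rewrite eq_complex /=;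
  apply/andP; split; apply/eqP; ring.
Qed.

Lemma quat_bM p q :
  quat_b (p * q) = quat_a p * quat_b q + quat_b p * conjc (quat_a q).
Proof.
by case: p q => [? ? ? ?] [? ? ? ?]; apply/eqP; rewrite eq_complex /=;
  apply/andP; split; apply/eqP; ring.
Qed.

Lemma conjqK : involutive (@conjq R).
Proof. by case=> a b c d; rewrite /conjq /= !opprK. Qed.

Lemma conjqM p q : conjq (p * q) = conjq q * conjq p.
Proof. by case: p q => [? ? ? ?] [? ? ? ?]; apply/quat_eqP; split=> /=; ring. Qed.

Definition realq r : quat R := Quat r 0 0 0.

Fact realq_is_additive : zmod_morphism realq.
Proof. by move=> r s; apply/quat_eqP; split=> //=; rewrite subrr. Qed.
HB.instance Definition _ :=
  GRing.isZmodMorphism.Build R (quat R) realq realq_is_additive.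

Fact realq_is_multiplicative : monoid_morphism realq.
Proof. by split=> // r s; apply/quat_eqP; split=> /=; ring. Qed.
HB.instance Definition _ :=
  GRing.isMonoidMorphism.Build R (quat R) realq realq_is_multiplicative.

Lemma realq_comm r q : realq r * q = q * realq r.
Proof. by case: q => *; apply/quat_eqP; split=> /=; ring. Qed.

Lemma conjq_realq r : conjq (realq r) = realq r.
Proof. by apply/quat_eqP; split=> //=; rewrite oppr0. Qed.

Lemma conjq_fixed q : conjq q = q -> q = realq (q0 q).
Proof. by case: q => a b c d /quat_eqP[/= _ h1 h2 h3]; apply/quat_eqP; split=> //=; lra. Qed.

Definition sqnormq q : R := q0 q ^+ 2 + q1 q ^+ 2 + q2 q ^+ 2 + q3 q ^+ 2.

Lemma conjq_mul q : conjq q * q = realq (sqnormq q).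
Proof. by case: q => *; apply/quat_eqP; rewrite /sqnormq; split=> /=; ring. Qed.

Lemma mul_conjq q : q * conjq q = realq (sqnormq q).
Proof. by case: q => *; apply/quat_eqP; rewrite /sqnormq; split=> /=; ring. Qed.

Lemma sqnormq_ge0 q : 0 <= sqnormq q.
Proof. by rewrite /sqnormq !addr_ge0 // sqr_ge0. Qed.

Lemma sqnormq_eq0 q : (sqnormq q == 0) = (q == 0).
Proof.
rewrite /sqnormq !paddr_eq0 ?addr_ge0 ?sqr_ge0 // !sqrf_eq0.
apply/idP/eqP => [/andP[/andP[/andP[/eqP ? /eqP ?] /eqP ?] /eqP ?]|->].
  exact/quat_eqP.
by rewrite /= !eqxx.
Qed.

Lemma adjq_mul m n k (P : 'M[quat R]_(m, n)) (Q : 'M[quat R]_(n, k)) :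
  adjq (P *m Q) = adjq Q *m adjq P.
Proof.
apply/matrixP => i j; rewrite !mxE raddf_sum /=; apply: eq_bigr => l _.
by rewrite !mxE conjqM.
Qed.

Lemma adjqK m n (P : 'M[quat R]_(m, n)) : adjq (adjq P) = P.
Proof. by apply/matrixP => i j; rewrite !mxE conjqK. Qed.

Lemma adjq1 n : adjq 1%:M = 1%:M :> 'M[quat R]_n.
Proof.
apply/matrixP => i j; rewrite !mxE eq_sym; case: eqP => _; rewrite ?raddf0 //.
exact: (conjq_realq 1).
Qed.

Lemma hyperhermitianE n (Q : 'M[quat R]_n) : hyperhermitian Q <-> adjq Q = Q.
Proof.
split=> [h|h j k]; first by apply/matrixP => i j; rewrite !mxE -h.
by rewrite -{1}h !mxE.
Qed.

End Quaternions.

(** * The embedding tau: multiplicativity, adjoints and image *)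

Section Tau.
Variable R : rcfType.
Local Notation C := R[i].
Local Notation cmx := (map_mx (@conjc R)).

Lemma map_conjcK m n (X : 'M[C]_(m, n)) : cmx (cmx X) = X.
Proof. by apply/matrixP => i j; rewrite !mxE conjcK. Qed.

Lemma map_quat_aM m n k (P : 'M[quat R]_(m, n)) (Q : 'M[quat R]_(n, k)) :
  map_mx (@quat_a R) (P *m Q) =
  map_mx (@quat_a R) P *m map_mx (@quat_a R) Q -
  map_mx (@quat_b R) P *m cmx (map_mx (@quat_b R) Q).
Proof.
apply/matrixP => i j; rewrite !mxE raddf_sum /= -sumrB; apply: eq_bigr => l _.
by rewrite !mxE quat_aM.
Qed.

Lemma map_quat_bM m n k (P : 'M[quat R]_(m, n)) (Q : 'M[quat R]_(n, k)) :
  map_mx (@quat_b R) (P *m Q) =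
  map_mx (@quat_a R) P *m map_mx (@quat_b R) Q +
  map_mx (@quat_b R) P *m cmx (map_mx (@quat_a R) Q).
Proof.
apply/matrixP => i j; rewrite !mxE raddf_sum /= -big_split; apply: eq_bigr => l _.
by rewrite !mxE quat_bM.
Qed.

Lemma tauM m n k (P : 'M[quat R]_(m, n)) (Q : 'M[quat R]_(n, k)) :
  tau (P *m Q) = tau P *m tau Q.
Proof.
rewrite /tau mulmx_block map_quat_aM map_quat_bM !map_mxD !map_mxN !map_mxM !map_conjcK.
apply: (f_equal4 (@block_mx _ _ _ _ _)).
- by rewrite mulNmx.
- by rewrite mulmxN mulNmx opprD.
- by rewrite addrC.
by rewrite mulmxN addrC.
Qed.

Fact tau_is_additive m n : zmod_morphism (@tau R m n).
Proof.
move=> P Q; rewrite /tau opp_block_mx add_block_mx !map_mxB.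
by rewrite !opprB opprK [- _ + _]addrC.
Qed.
HB.instance Definition _ m n := GRing.isZmodMorphism.Build
  'M[quat R]_(m, n) 'M[C]_(m + m, n + n) (@tau R m n) (@tau_is_additive m n).

Lemma tau_inj m n : injective (@tau R m n).
Proof.
move=> P Q /eq_block_mx[+ /oppr_inj + _ _] => /matrixP Ea /matrixP Eb.
apply/matrixP => i j; move: (Ea i j) (Eb i j); rewrite !mxE => -[? ?] [? ?].
exact/quat_eqP.
Qed.

Lemma tau_diag n (d : 'rV[R]_n) :
  let D := diag_mx (map_mx (real_complex R) d) in
  tau (diag_mx (map_mx (@realq R) d)) = block_mx D 0 0 D.
Proof.
rewrite /=; congr block_mx; apply/matrixP => i j; rewrite !mxE;
  case: (i == j); rewrite ?mulr1n ?mulr0n //.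
all: by apply/eqP; rewrite eq_complex /= ?oppr0 !eqxx.
Qed.

Lemma tau1 n : tau 1%:M = 1%:M :> 'M[C]_(n + n).
Proof.
have := tau_diag (const_mx 1 : 'rV_n).
by rewrite /= !map_const_mx !rmorph1 !diag_const_mx -scalar_mx_block.
Qed.

Lemma tau_realZ m n r (P : 'M[quat R]_(m, n)) :
  tau (realq r *: P) = r%:C *: tau P.
Proof.
rewrite scale_block_mx; congr block_mx; apply/matrixP => i j; rewrite !mxE /=;
case: (P i j) => ? ? ? ?; apply/eqP; rewrite eq_complex /=;
by apply/andP; split; apply/eqP; ring.
Qed.

Lemma tau_adjq m n (P : 'M[quat R]_(m, n)) : tau (adjq P) = (cmx (tau P))^T.
Proof.
rewrite map_block_mx tr_block_mx; congr block_mx;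
apply/matrixP => i j; rewrite !mxE /=; case: (P j i) => ? ? ? ? /=;
by apply/eqP; rewrite eq_complex /= ?opprK !eqxx.
Qed.

Lemma Jmx_tau m n (P : 'M[quat R]_(m, n)) :
  Jmx R m *m tau P = cmx (tau P) *m Jmx R n.
Proof.
rewrite /tau /Jmx map_block_mx !mulmx_block map_mxN !map_conjcK.
by rewrite !(mul0mx, mulmx0, mul1mx, mulmx1, mulNmx, mulmxN, add0r, addr0, opprK).
Qed.

Lemma Jmx_sqr n : Jmx R n *m Jmx R n = - 1%:M.
Proof.
rewrite /Jmx mulmx_block !(mul0mx, mulmx0, mul1mx, mulmx1, add0r, addr0).
by rewrite [in RHS]scalar_mx_block opp_block_mx !oppr0.
Qed.

Lemma Jmx_tr n : (Jmx R n)^T = - Jmx R n.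
Proof. by rewrite /Jmx tr_block_mx opp_block_mx !trmx0 !oppr0 opprK linearN /= trmx1. Qed.

Lemma Jmx_conj n : cmx (Jmx R n) = Jmx R n.
Proof. by rewrite /Jmx map_block_mx !raddf0 map_mxN map_mx1. Qed.

(** The transpose of tau(P) is the conjugate of [tau (adjq P)], and J exchanges a matrix in the
    image of tau with its conjugate. *)
Lemma tau_tr_Jmx m n (P : 'M[quat R]_(m, n)) :
  (tau P)^T *m Jmx R m = Jmx R n *m tau (adjq P).
Proof. by rewrite Jmx_tau tau_adjq -map_trmx map_conjcK. Qed.

(** Comparing blocks, the relation expresses the lower blocks of X as conj(a) and conj(b) for the
    upper blocks a and -b. *)
Lemma tau_image m n (X : 'M[C]_(m + m, n + n)) :
  Jmx R m *m X = cmx X *m Jmx R n -> exists P : 'M[quat R]_(m, n), X = tau P.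
Proof.
rewrite -(submxK X) /Jmx map_block_mx !mulmx_block.
rewrite !(mul0mx, mulmx0, mul1mx, mulmx1, mulNmx, mulmxN, add0r, addr0).
move/eq_block_mx => [-> -> _ _].
exists (\matrix_(i, j) Quat (complex.Re (ulsubmx X i j)) (complex.Im (ulsubmx X i j))
          (- complex.Re (ursubmx X i j)) (- complex.Im (ursubmx X i j))).
rewrite /tau; congr block_mx; apply/matrixP => i j; rewrite !mxE /quat_a /quat_b /=.
all: by case: (X _ _) => ? ?; apply/eqP; rewrite eq_complex /= ?opprK !eqxx.
Qed.

End Tau.

(** * Spectral theorem for hyperhermitian matrices *)

Section Spectral.
Variable R : rcfType.
Local Notation H := (quat R).

Lemma mulmx_realZ m n k r (P : 'M[H]_(m, n)) (Q : 'M[H]_(n, k)) :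
  P *m (realq r *: Q) = realq r *: (P *m Q).
Proof.
apply/matrixP => i j; rewrite !mxE mulr_sumr; apply: eq_bigr => l _.
by rewrite !mxE !mulrA realq_comm.
Qed.

Lemma mul_mx_real_scalar m n r (P : 'M[H]_(m, n)) :
  P *m (realq r)%:M = realq r *: P.
Proof. by rewrite -[(realq r)%:M]scalemx1 mulmx_realZ mulmx1. Qed.

Lemma adjq_is_additive m n : zmod_morphism (@adjq R m n).
Proof. by move=> P Q; rewrite /adjq map_mxB linearB. Qed.
HB.instance Definition _ m n := GRing.isZmodMorphism.Build
  'M[H]_(m, n) 'M[H]_(n, m) (@adjq R m n) (@adjq_is_additive m n).

Lemma adjq_realZ m n r (P : 'M[H]_(m, n)) : adjq (realq r *: P) = realq r *: adjq P.
Proof. by apply/matrixP => i j; rewrite !mxE conjqM conjq_realq realq_comm. Qed.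

Lemma adjq_block m1 m2 n1 n2 (P : 'M[H]_(m1, n1)) Q S (T : 'M[H]_(m2, n2)) :
  adjq (block_mx P Q S T) = block_mx (adjq P) (adjq S) (adjq Q) (adjq T).
Proof. by rewrite /adjq map_block_mx tr_block_mx. Qed.

Lemma unitaryq1 n : unitaryq (1%:M : 'M[H]_n).
Proof. by split; rewrite adjq1 mulmx1. Qed.

Lemma unitaryq_adj n (U : 'M[H]_n) : unitaryq U -> unitaryq (adjq U).
Proof. by case=> h1 h2; split; rewrite adjqK. Qed.

Lemma unitaryq_mul n (U V : 'M[H]_n) : unitaryq U -> unitaryq V -> unitaryq (U *m V).
Proof.
case=> u1 u2 [v1 v2]; split; rewrite adjq_mul mulmxA.
  by rewrite -[adjq V *m _ *m _]mulmxA u1 mulmx1.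
by rewrite -[U *m _ *m _]mulmxA v2 mulmx1.
Qed.

(** The squared Euclidean norm, so that no square root is taken. *)
Definition rownorm n (N : 'rV[H]_n) : R := \sum_l sqnormq (N 0 l).

Lemma mul_adjq_row n (N : 'rV[H]_n) : N *m adjq N = (realq (rownorm N))%:M.
Proof.
apply/matrixP => i j; rewrite !ord1 !mxE mulr1n raddf_sum; apply: eq_bigr => l _.
by rewrite !mxE mul_conjq.
Qed.

Lemma rownorm_ge0 n (N : 'rV[H]_n) : 0 <= rownorm N.
Proof. by apply: sumr_ge0 => l _; apply: sqnormq_ge0. Qed.

Lemma rownorm_eq0 n (N : 'rV[H]_n) : (rownorm N == 0) = (N == 0).
Proof.
rewrite psumr_eq0 => [|l _]; last exact: sqnormq_ge0.
apply/allP/eqP => [h|-> l _]; last by rewrite mxE sqnormq_eq0 eqxx.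
by apply/rowP => l; move/(_ l (mem_index_enum _)): h; rewrite mxE sqnormq_eq0 => /eqP.
Qed.

(** The upper row of tau(N) is (a, -b) for N = a + b j; it identifies quaternionic rows with complex
    rows of twice the length. *)
Lemma usubmx_tau_inj n : injective (fun N : 'rV[H]_n => usubmx (tau N)).
Proof.
move=> N P; rewrite /= /tau !block_mxEv !col_mxKu => /eq_row_mx[Ea /oppr_inj Eb].
apply: tau_inj; by rewrite /tau Ea Eb.
Qed.

Lemma hyperherm_eigenrow n (Q : 'M[H]_n.+1) : adjq Q = Q ->
  exists (N : 'rV[H]_n.+1) (r : R), N != 0 /\ N *m Q = realq r *: N.
Proof.
move=> QH; have [|a /eigenvalueP[x xQ x0]] := eigenvalue_closed (tau Q); first by [].
(* The quaternionic row whose tau has upper row x; the signs come from the block -b of tau. *)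
pose N : 'rV[H]_n.+1 := \row_l
  Quat (complex.Re (lsubmx x 0 l)) (complex.Im (lsubmx x 0 l))
       (- complex.Re (rsubmx x 0 l)) (- complex.Im (rsubmx x 0 l)).
have tauN : usubmx (tau N) = x.
  rewrite /tau block_mxEv col_mxKu -[RHS]hsubmxK; congr row_mx; apply/rowP => l;
  by rewrite !mxE; case: (x _ _) => ? ?; apply/eqP; rewrite eq_complex /= ?opprK !eqxx.
(* Left multiplication by a complex number is plain scaling on the upper row of tau, so the complex
   eigenvalue equation lifts to N. *)
have NQ : N *m Q = complex_quat a *: N.
  apply: usubmx_tau_inj; rewrite /= tauM -mul_usub_mx tauN xQ.
  have -> : usubmx (tau (complex_quat a *: N)) = a *: usubmx (tau N).
    rewrite /tau !block_mxEv !col_mxKu scale_row_mx; congr row_mx; apply/rowP => l;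
    rewrite !mxE ?quat_aM ?quat_bM; case: (a) => ? ?;
    by apply/eqP; rewrite eq_complex /=; apply/andP; split; apply/eqP; ring.
  by rewrite tauN.
have N0 : N != 0 by apply: contra x0 => /eqP N0; rewrite -tauN N0 raddf0 linear0.
exists N, (q0 (complex_quat a)); split=> //; rewrite NQ; congr (_ *: _).
(* The eigenvalue is real: N Q N^* is a 1 x 1 hyperhermitian matrix equal to the eigenvalue times
   the nonzero real |N|^2, which cancels. *)
apply: conjq_fixed; have /matrixP/(_ 0 0) : adjq (N *m Q *m adjq N) = N *m Q *m adjq N.
  by rewrite !adjq_mul adjqK QH mulmxA.
rewrite NQ -scalemxAl mul_adjq_row !mxE mulr1n conjqM conjq_realq realq_comm.
have u : realq (rownorm N) * realq (rownorm N)^-1 = 1.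
  by rewrite -rmorphM mulfV ?rmorph1 // rownorm_eq0.
by move/(congr1 ( *%R^~ (realq (rownorm N)^-1))); rewrite -!mulrA u !mulr1.
Qed.

(* The reflection exchanging N and the first basis row; over the quaternions it
   does so only because the first entry of N is real. *)
Lemma householder n (N : 'rV[H]_n.+1) t : rownorm N = 1 -> N 0 0 = realq t ->
  exists2 U : 'M[H]_n.+1, unitaryq U & delta_mx 0 0 *m U = N.
Proof.
move=> N1 N00; pose e : 'rV[H]_n.+1 := delta_mx 0 0.
case: (eqVneq (N - e) 0) => [/eqP|u0].
  by rewrite subr_eq0 => /eqP->; exists 1%:M; [exact: unitaryq1 | rewrite mulmx1].
pose u := N - e; pose s := rownorm u.
have s0 : s != 0 by rewrite rownorm_eq0.
have mul_e (P : 'rV[H]_n.+1) : e *m adjq P = (conjq (P 0 0))%:M.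
  by rewrite -rowE; apply/matrixP => i j; rewrite !ord1 !mxE mulr1n.
have e_mul (P : 'rV[H]_n.+1) : P *m adjq e = (P 0 0)%:M.
  by rewrite -[LHS]adjqK adjq_mul adjqK mul_e; apply/matrixP => i j;
     rewrite !ord1 !mxE !mulr1n conjqK.
have e00 : e 0 0 = 1 by rewrite mxE.
(* |N - e|^2 = |N|^2 + |e|^2 - 2t, both cross terms being the real number t. *)
have sE : s = 2 - 2 * t.
  have : u *m adjq u = (realq (2 - 2 * t))%:M.
    rewrite raddfB mulmxBl !mulmxBr mul_adjq_row N1 mul_e !e_mul e00 N00 conjq_realq.
    by rewrite -!raddfB /=; congr (realq _)%:M; ring.
  by rewrite mul_adjq_row => /matrixP/(_ 0 0); rewrite !mxE !mulr1n => -[].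
pose U := 1%:M - realq (2 / s) *: (adjq u *m u).
have UH : adjq U = U by rewrite raddfB /= adjq1 adjq_realZ adjq_mul adjqK.
pose W := adjq u *m u.
have WW : W *m W = realq s *: W.
  by rewrite mulmxA -[W *m _]mulmxA mul_adjq_row mul_mx_real_scalar -scalemxAl.
have UU : U *m U = 1%:M.
  rewrite mulmxBl mul1mx mulmxBr mulmx1 -/W -scalemxAl mulmx_realZ WW !scalerA.
  rewrite -!rmorphM /= [X in _ - _ - X](_ : _ = - (realq (2 / s) *: W)).
    by rewrite opprK subrK.
  rewrite -scalerBl -scaleNr -raddfB -raddfN /=; congr (realq _ *: _).
  by field.
exists U; first by split; rewrite UH.
(* Here e U = e - (2/s) conj(u_0) u with u_0 = t - 1 and s = 2 - 2t, so the coefficient of u is +1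
   and e U = e + u = N. *)
rewrite mulmxBr mulmx1 mulmx_realZ mulmxA mul_e mul_scalar_mx scalerA.
have -> : u 0 0 = realq (t - 1) by rewrite mxE N00 mxE e00 raddfB.
rewrite conjq_realq -rmorphM /= [X in realq X](_ : _ = -1).
  by rewrite rmorphN1 scaleN1r opprK addrC subrK.
by move: s0; rewrite sE => ?; field.
Qed.

Lemma normalize_row n (N : 'rV[H]_n.+1) : N != 0 ->
  exists (c : H) (t : R), rownorm (c *: N) = 1 /\ (c *: N) 0 0 = realq t.
Proof.
(* Multiplying by the conjugate of the first entry makes that entry real; if it is 0, the factor 1
   already does. The real factor r below then fixes the norm. *)
move=> N0; pose q : H := if N 0 0 == 0 then 1 else conjq (N 0 0).
have q0 : sqnormq q != 0.
  rewrite sqnormq_eq0 /q; case: (eqVneq (N 0 0) 0) => [_|h]; first exact: oner_neq0.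
  by apply: contra h => /eqP h; rewrite -[N 0 0]conjqK h raddf0.
have [t qt] : exists t, q * N 0 0 = realq t.
  rewrite /q; case: eqP => [->|_]; first by exists 0; rewrite mulr0 raddf0.
  by exists (sqnormq (N 0 0)); rewrite conjq_mul.
pose d := sqnormq q * rownorm N.
have d0 : 0 < d.
  by rewrite lt_def mulf_neq0 ?rownorm_eq0 //= mulr_ge0 ?rownorm_ge0 ?sqnormq_ge0.
pose r := Num.sqrt d^-1; exists (realq r * q), (r * t); split; last first.
  by rewrite mxE -mulrA qt -rmorphM.
rewrite /rownorm; under eq_bigr => l _ do rewrite mxE.
have sqM (x y : H) : sqnormq (x * y) = sqnormq x * sqnormq y.
  by case: x y => [????] [????]; rewrite /sqnormq /=; ring.
under eq_bigr => l _ do rewrite !sqM.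
rewrite -mulr_sumr -/(rownorm N) -mulrA -/d /sqnormq /= expr0n !addr0 sqr_sqrtr.
  by rewrite mulVf // gt_eqF.
by rewrite invr_ge0 ltW.
Qed.

(** Induction on n. A unitary U taking the first basis row to a unit eigenrow gives U Q U^* the
    first row (r, 0), hence by symmetry the matching first column, and the remaining block is
    hyperhermitian of smaller size. *)
Theorem hyperherm_spectral n (Q : 'M[H]_n) : adjq Q = Q ->
  exists (E : 'M[H]_n) (nu : 'rV[R]_n),
    unitaryq E /\ adjq E *m Q *m E = diag_mx (map_mx (@realq R) nu).
Proof.
elim: n Q => [|n IHn] Q QH.
  exists 1%:M, 0; split; first exact: unitaryq1.
  by apply/matrixP => -[].
have [N [r [N0 NQ]]] := hyperherm_eigenrow QH.
have [c [t [cN1 cN00]]] := normalize_row N0.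
(* Left scaling by a quaternion c keeps the eigenrow because r is real and so commutes with c. *)
have cNQ : (c *: N) *m Q = realq r *: (c *: N).
  by rewrite -scalemxAl NQ !scalerA realq_comm.
have [U UU eU] := householder cN1 cN00; have [U1 U2] := UU.
pose P : 'M[H]_(1 + n) := U *m Q *m adjq U.
have PH : adjq P = P by rewrite !adjq_mul adjqK QH mulmxA.
have eP : row 0 P = realq r *: delta_mx 0 0.
  by rewrite rowE !mulmxA eU cNQ -eU -!scalemxAl -mulmxA U2 mulmx1.
have defP : P = U *m Q *m adjq U by [].
clearbody P; have hP := (hyperhermitianE P).2 PH.
have PE : P = block_mx (realq r)%:M 0 0 (drsubmx P).
  have Pu : ursubmx P = 0.
    apply/matrixP => i j; rewrite !ord1 !mxE.
    have /rowP/(_ (rshift 1 j)) := eP; rewrite !mxE /= mulr0 => <-.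
    by congr (P _ _); apply: val_inj.
  rewrite -[LHS]submxK; congr block_mx => //.
    apply/matrixP => i j; rewrite !ord1 !mxE.
    have /rowP/(_ (lshift n 0)) := eP; rewrite !mxE eqxx /= mulr1 mulr1n => <-.
    by congr (P _ _); apply: val_inj.
  apply/matrixP => i j; have /matrixP/(_ j i) := Pu.
  by rewrite !mxE => Pji0; rewrite hP Pji0 raddf0.
have P'H : adjq (drsubmx P) = drsubmx P.
  by apply/matrixP => i j; rewrite !mxE -hP.
have [E' [nu [[E1 E2] E'P]]] := IHn _ P'H.
pose B : 'M[H]_(1 + n) := block_mx 1%:M 0 0 E'.
have adjB : adjq B = block_mx 1%:M 0 0 (adjq E').
  by rewrite adjq_block adjq1 !raddf0.
have BU : unitaryq B.
  split; rewrite adjB mulmx_block !(mul0mx, mulmx0, mul1mx, add0r, addr0) ?E1 ?E2;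
  by rewrite -scalar_mx_block.
have DE : diag_mx (map_mx (@realq R) (row_mx r%:M nu)) =
    block_mx (realq r)%:M 0 0 (diag_mx (map_mx (@realq R) nu)).
  rewrite map_row_mx diag_mx_row; congr block_mx.
  by apply/matrixP => i j; rewrite !ord1 !mxE !mulr1n.
exists (adjq U *m B), (row_mx r%:M nu : 'rV_(1 + n)); split.
  exact: (@unitaryq_mul (1 + n) _ _ (unitaryq_adj UU) BU).
rewrite adjq_mul adjqK; have -> : adjq B *m U *m Q *m (adjq U *m B) = adjq B *m P *m B.
  by rewrite defP !mulmxA.
rewrite PE adjB !mulmx_block !(mul0mx, mulmx0, mul1mx, mulmx1, add0r, addr0) E'P.
exact/esym.
Qed.

End Spectral.

(** * Real forms and strongly positive forms *)

Section RealForms.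
Variables (R : realType) (n : nat).
Local Notation C := R[i].
Local Notation H := (quat R).
Local Notation cmx := (map_mx (@conjc R)).
Local Notation J := (Jmx R n).
Variable w : (n + n).-tuple 'rV[C]_(n + n).
Hypothesis hw : basis_of fullv w.
Implicit Types (M : 'M[C]_(n + n)) (N : 'rV[H]_n).

(** W holds the basis vectors as rows in standard coordinates; W' holds the coordinates of the
    standard vectors in the basis, and is the inverse of W. *)
Let W : 'M[C]_(n + n) := \matrix_A tnth w A.
Let W' : 'M[C]_(n + n) := \matrix_(i, A) coord w A (delta_mx 0 i).

Lemma mulmx_tr_congr m k p (K : 'M[C]_m) (X : 'M[C]_(m, k)) (V : 'M[C]_(k, p)) :
  (X *m V)^T *m K *m (X *m V) = V^T *m (X^T *m K *m X) *m V.
Proof. by rewrite trmx_mul !mulmxA. Qed.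

Lemma row_mulW m (X : 'M[C]_(m, n + n)) i : row i (X *m W) = \sum_j X i j *: tnth w j.
Proof. by rewrite row_mul mulmx_sum_row; apply: eq_bigr => j _; rewrite mxE rowK. Qed.

Lemma mulW'W : W' *m W = 1%:M.
Proof.
apply/row_matrixP => i; rewrite row_mulW row1.
under eq_bigr => j _ do rewrite mxE (tnth_nth 0).
by rewrite -(coord_basis hw) ?memvf.
Qed.

Lemma unitW : W \in unitmx.
Proof. by case/mulmx1_unit: mulW'W. Qed.

Lemma coord_tnth A B : coord w A (tnth w B) = (B == A)%:R.
Proof. by rewrite (tnth_nth 0) coord_free ?(basis_free hw). Qed.

Lemma two_formE M : two_form w M = skewform (W^T *m M *m W).
Proof.
rewrite -sum_wedge_rows; apply: eq_bigr => A _; apply: eq_bigr => B _.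
by rewrite !rowK.
Qed.

Fact two_form_is_linear : linear (two_form w).
Proof.
by move=> a M M'; rewrite !two_formE mulmxDr mulmxDl -scalemxAr -scalemxAl linearP.
Qed.
HB.instance Definition _ :=
  GRing.isLinear.Build C 'M[C]_(n + n) (extalg C (n + n)) _ (two_form w)
    two_form_is_linear.

(** For skew matrices the 2-form determines twice the congruence by W; the factor 2 cancels in
    characteristic 0 and W is invertible. *)
Lemma two_form_inj M M' : M^T = - M -> M'^T = - M' ->
  two_form w M = two_form w M' -> M = M'.
Proof.
have sk X : X^T = - X -> (W^T *m X *m W)^T = - (W^T *m X *m W).
  by move=> skX; rewrite !trmx_mul trmxK skX mulNmx mulmxN mulmxA.
move=> skM skM'; rewrite !two_formE => /skewform_eqP.
rewrite (sk _ skM) (sk _ skM') 2!opprK => E.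
have {E} : W^T *m M *m W = W^T *m M' *m W.
  apply/matrixP => i j; have /matrixP/(_ i j) := E.
  by rewrite [LHS]mxE [RHS]mxE -!mulr2n => /eqP; rewrite eqrMn2r // => /eqP.
move/(can_inj (mulmxK unitW)); apply: (can_inj (mulKmx _)).
by rewrite unitmx_tr unitW.
Qed.

Lemma act_tnth M A : act w M (tnth w A) = row A (M *m W).
Proof.
rewrite /act row_mulW (bigD1 A) //= [X in _ + X]big1 ?addr0 => [|B /negPf neB].
  by rewrite coord_tnth eqxx scale1r.
by rewrite coord_tnth eq_sym neB scale0r.
Qed.

Lemma ext_rhoj_two_form M :
  ext_rhoj w (two_form w M) = two_form w (J^T *m cmx M *m J).
Proof.
rewrite !two_formE; pose P : 'M[C]_(n + n) := \matrix_i rhoj w (delta_mx 0 i).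
transitivity (skewform (P^T *m cmx (W^T *m M *m W) *m P)).
  exact: extmap_skewform.
(* This says that rho(j) sends omega^A to J.omega^A. The conjugate on W comes from antilinearity,
   and it matches the conjugate of W^T M W in the goal. *)
have WP : cmx W *m P = J *m W.
  have -> : P = cmx W' *m (J *m W).
    apply/row_matrixP => i; rewrite rowK row_mul mulmx_sum_row.
    by apply: eq_bigr => A _; rewrite act_tnth !mxE.
  by rewrite mulmxA -map_mxM (mulmx1C mulW'W) map_mx1 mul1mx.
clearbody P; apply: (congr1 (@skewform _ _)).
rewrite (map_mxM _ (W^T *m M)) (map_mxM _ W^T) -map_trmx.
have := mulmx_tr_congr (cmx M) (cmx W) P; rewrite WP => E.
apply: etrans (esym E) _.
exact: mulmx_tr_congr.
Qed.

Lemma real_two_form M : M^T = - M ->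
  real_form w 1 (two_form w M) <-> J^T *m cmx M *m J = M.
Proof.
move=> skM; rewrite /real_form ext_rhoj_two_form; split=> [[_] | ->].
  apply: two_form_inj => //.
  by rewrite !trmx_mul trmxK map_trmx skM map_mxN mulNmx mulmxN mulmxA.
by split=> //; rewrite two_formE; apply: skewform_extpow.
Qed.

Lemma real_tauJ (Q : 'M[H]_n) : J^T *m cmx (tau Q *m J) *m J = tau Q *m J.
Proof.
rewrite map_mxM Jmx_conj Jmx_tr -!mulmxA Jmx_sqr mulmxN mulmx1 mulNmx mulmxN opprK.
by rewrite -{1}Jmx_conj -map_mxM Jmx_tau map_mxM map_conjcK Jmx_conj.
Qed.

Lemma real_Jtau (Q : 'M[H]_n) : J^T *m cmx (J *m tau Q) *m J = J *m tau Q.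
Proof.
rewrite map_mxM Jmx_conj Jmx_tr mulmxA mulNmx Jmx_sqr opprK mul1mx.
by rewrite -Jmx_tau.
Qed.

Lemma skew_Jtau (Q : 'M[H]_n) : adjq Q = Q -> (J *m tau Q)^T = - (J *m tau Q).
Proof. by move=> QH; rewrite trmx_mul Jmx_tr mulmxN tau_tr_Jmx QH. Qed.

(** Reality makes X = -M J satisfy J X = conj(X) J, so X = tau(Q), and M = X J since J^2 = -1.
    Skewness of M then becomes Q^* = Q. *)
Lemma real_skew_tauJ M : M^T = - M -> J^T *m cmx M *m J = M ->
  exists Q : 'M[H]_n, adjq Q = Q /\ M = tau Q *m J.
Proof.
rewrite Jmx_tr !mulNmx => skM realM.
have XE : - (M *m J) = - (J *m cmx M).
  by rewrite -{1}realM mulNmx opprK -!mulmxA Jmx_sqr mulmxN mulmx1 mulmxN.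
have [|Q XQ] := @tau_image _ _ _ (- (M *m J)).
  rewrite [in LHS]XE mulmxN mulmxA Jmx_sqr mulNmx mul1mx opprK map_mxN map_mxM Jmx_conj.
  by rewrite mulNmx -mulmxA Jmx_sqr mulmxN mulmx1 opprK.
exists Q; split; last by rewrite -XQ mulNmx -mulmxA Jmx_sqr mulmxN mulmx1 opprK.
apply: tau_inj; rewrite tau_adjq -XQ map_mxN map_mxM Jmx_conj linearN /= trmx_mul Jmx_tr.
by rewrite map_trmx skM map_mxN mulmxN mulNmx opprK XE.
Qed.

(** The same with J on the left, the side on which congruence by tau(E) acts on Q as E^* Q E. *)
Lemma real_skew_Jtau M : M^T = - M -> J^T *m cmx M *m J = M ->
  exists Q : 'M[H]_n, adjq Q = Q /\ M = J *m tau Q.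
Proof.
rewrite Jmx_tr !mulNmx => skM realM.
have XE : - (J *m M) = - (cmx M *m J).
  by rewrite -{1}realM mulmxN opprK !mulmxA Jmx_sqr !mulNmx mul1mx.
have [|Q XQ] := @tau_image _ _ _ (- (J *m M)).
  rewrite mulmxN mulmxA Jmx_sqr mulNmx mul1mx opprK map_mxN map_mxM Jmx_conj.
  by rewrite mulNmx realM.
exists Q; split; last by rewrite -XQ mulmxN mulmxA Jmx_sqr mulNmx mul1mx opprK.
apply: tau_inj; rewrite tau_adjq -XQ map_mxN map_mxM Jmx_conj linearN /= trmx_mul Jmx_tr.
by rewrite map_trmx skM map_mxN mulmxN mulNmx opprK XE.
Qed.

(** * Normal matrices and pullbacks along quaternionic rows *)

Lemma normal_mxE (nu : 'rV[R]_n) :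
  normal_mx nu = J *m tau (diag_mx (map_mx (@realq R) nu)).
Proof.
rewrite tau_diag /Jmx mulmx_block /normal_mx.
by rewrite !(mul0mx, mulmx0, mul1mx, mulNmx, oppr0, addr0, add0r).
Qed.

Lemma pullE N p : pull w N p = row p (tau N *m W).
Proof. by rewrite row_mulW. Qed.

Definition pull_form N := wedge (ext1 (pull w N (lshift 1 ord0)))
                                (ext1 (pull w N (rshift 1 ord0))).

(** If u and d are the two rows of tau(N), then u^T d - d^T u = tau(N)^T J tau(N) = J tau(N^* N).
    The factor 2 appears because u^T d is replaced by its antisymmetrization. *)
Lemma pull_formE N :
  2 *: pull_form N = two_form w (J *m tau (adjq N *m N)).
Proof.
rewrite /pull_form wedge_ext1 two_formE !pullE !row_mul.
have -> : J *m tau (adjq N *m N) =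
    (usubmx (tau N))^T *m dsubmx (tau N) - (dsubmx (tau N))^T *m usubmx (tau N).
  rewrite tauM mulmxA -tau_tr_Jmx -{1 2}(vsubmxK (tau N)) tr_col_mx /Jmx.
  rewrite mul_row_block !(mulmx0, mulmx1, mulmxN, add0r, addr0) mul_row_col.
  by rewrite mulNmx addrC.
have -> : row (lshift 1 ord0) (tau N) = usubmx (tau N).
  by apply/rowP => j; rewrite !mxE.
have -> : row (rshift 1 ord0) (tau N) = dsubmx (tau N).
  by apply/rowP => j; rewrite !mxE.
rewrite -skewform_antisym !trmx_mul !trmxK mulmxBr mulmxBl.
by rewrite !mulmxA.
Qed.

Lemma pull_form_real N : real_form w 1 (pull_form N).
Proof.
have -> : pull_form N = two_form w (2^-1 *: (J *m tau (adjq N *m N))).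
  by rewrite linearZ /= -pull_formE scalerA mulVf ?scale1r // pnatr_eq0.
have NH : adjq (adjq N *m N) = adjq N *m N by rewrite adjq_mul adjqK.
apply/real_two_form; first by rewrite linearZ /= skew_Jtau // scalerN.
rewrite map_mxZ fmorphV rmorph_nat -scalemxAr -scalemxAl.
by rewrite real_Jtau.
Qed.

Lemma pull_form_elem N : N != 0 -> elem_strongly_positive w (pull_form N).
Proof.
move=> N0; split; first exact: pull_form_real.
exists (fun q => \sum_l N 0 l * q l 0), N; split=> //.
  split=> [q q'|q c]; last first.
    by rewrite mulr_suml; apply: eq_bigr => l _; rewrite mxE mulrA.
  by rewrite -big_split; apply: eq_bigr => l _; rewrite mxE mulrDr.
have [k Nk] : exists k, N 0 k != 0.
  apply/existsP; apply: contraR N0 => /existsPn h; apply/eqP/rowP => k.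
  by rewrite mxE; apply/eqP; have := h k; rewrite negbK.
exists (delta_mx k 0); apply/eqP; rewrite (bigD1 k) //= big1 ?addr0 => [|l /negPf nel].
  by rewrite mxE !eqxx mulr1.
by rewrite mxE nel mulr0.
Qed.

(** Rows l and n + l of tau(Q) are the two rows of tau of the l-th row of Q. Together with
    [actq_rshift] this turns the wedge of the two transformed basis vectors into a [pull_form]. *)
Lemma actq_lshift (Q : 'M[H]_n) l :
  actq w Q (tnth w (lshift n l)) = pull w (row l Q) (lshift 1 ord0).
Proof.
rewrite /actq act_tnth row_mulW; apply: eq_bigr => j _; congr (_ *: _).
by rewrite /tau !block_mxEv !col_mxEu !mxE; case: split => k; rewrite !mxE.
Qed.

Lemma actq_rshift (Q : 'M[H]_n) l :
  actq w Q (tnth w (rshift n l)) = pull w (row l Q) (rshift 1 ord0).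
Proof.
rewrite /actq act_tnth row_mulW; apply: eq_bigr => j _; congr (_ *: _).
by rewrite /tau !block_mxEv !col_mxEd !mxE; case: split => k; rewrite !mxE.
Qed.

(** Rank-one decomposition: the l-th row of E^* is the row whose pullback carries the coefficient
    nu_l. *)
Lemma diag_sum (E : 'M[H]_n) (nu : 'rV[R]_n) :
  E *m diag_mx (map_mx (@realq R) nu) *m adjq E =
  \sum_l realq (nu 0 l) *: (adjq (row l (adjq E)) *m row l (adjq E)).
Proof.
apply/matrixP => i j; rewrite mxE summxE; apply: eq_bigr => l _.
rewrite mul_mx_diag !mxE big_ord1 !mxE conjqK mulrA; congr (_ * _).
by rewrite realq_comm.
Qed.

Lemma two_form_pull (I : finType) (c : I -> R) (N : I -> 'rV[H]_n) :
  2 *: \sum_i (c i)%:C *: pull_form (N i) =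
  two_form w (J *m tau (\sum_i realq (c i) *: (adjq (N i) *m N i))).
Proof.
rewrite scaler_sumr (raddf_sum (@tau R n n)) mulmx_sumr linear_sum; apply: eq_bigr => i _ /=.
by rewrite tau_realZ -scalemxAr [RHS]linearZ /= -pull_formE !scalerA mulrC.
Qed.

(** Strong positivity asks for a sum indexed by an initial segment with at least one term;
    enumerating the nonempty set P provides it. *)
Lemma strongly_positive_sum (I : finType) (P : pred I) (c : I -> R) (N : I -> 'rV[H]_n) phi :
  real_form w 1 phi -> (exists i, P i) -> (forall i, P i -> 0 < c i) ->
  (forall i, P i -> N i != 0) ->
  phi = \sum_(i | P i) (c i)%:C *: pull_form (N i) ->
  strongly_positive w phi.
Proof.
move=> rphi [i0 Pi0] c0 N0 phiE; split=> //.
pose s := enum P.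
have s0 : (0 < size s)%N by rewrite -cardE; apply/card_gt0P; exists i0.
have Ps k : (k < size s)%N -> P (nth i0 s k).
  by move=> ks; have := mem_nth i0 ks; rewrite mem_enum.
exists (size s).-1, (fun k => c (nth i0 s k)), (fun k => pull_form (N (nth i0 s k))).
have lt_s (k : 'I_(size s).-1.+1) : (k < size s)%N by rewrite -[X in (_ < X)%N](prednK s0).
split=> [k|k|]; first exact/c0/Ps.
  exact/pull_form_elem/N0/Ps.
rewrite phiE -big_enum /= -/s (big_nth i0) big_mkord.
by rewrite -[in LHS](prednK s0).
Qed.

End RealForms.

(** * Normal form *)

Section Normalization.
Variables (R : realType) (n : nat).
Local Notation C := R[i].
Local Notation H := (quat R).
Local Notation J := (Jmx R n).
Variable w : (n + n).-tuple 'rV[C]_(n + n).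
Hypothesis hw : basis_of fullv w.
Implicit Types (M : 'M[C]_(n + n)) (N : 'rV[H]_n).

Lemma Jmx_cancel (X Y : 'M[C]_(n + n)) : J *m X = J *m Y -> X = Y.
Proof.
move/(congr1 (mulmx J)); rewrite !mulmxA Jmx_sqr.
by rewrite !mulNmx !mul1mx => /oppr_inj.
Qed.

(** Undoes the congruence: tau(E) is invertible with inverse [tau (adjq E)]. *)
Lemma normal_mxP (E : 'M[H]_n) (nu : 'rV[R]_n) M : unitaryq E ->
  (tau E)^T *m M *m tau E = normal_mx nu ->
  M = J *m tau (E *m diag_mx (map_mx (@realq R) nu) *m adjq E).
Proof.
case=> _ E2 EM; have tE : tau E *m tau (adjq E) = 1%:M by rewrite -tauM E2 tau1.
have tEt : (tau (adjq E))^T *m (tau E)^T = 1%:M by rewrite -trmx_mul tE trmx1.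
have -> : M = (tau (adjq E))^T *m ((tau E)^T *m M *m tau E) *m tau (adjq E).
  by rewrite !mulmxA tEt mul1mx -mulmxA tE mulmx1.
by rewrite EM normal_mxE mulmxA tau_tr_Jmx adjqK -!mulmxA !tauM mulmxA.
Qed.

Lemma exists_normal_form M : M^T = - M -> real_form w 1 (two_form w M) ->
  exists (E : 'M[H]_n) (nu : 'rV[R]_n),
    unitaryq E /\ (tau E)^T *m M *m tau E = normal_mx nu.
Proof.
move=> skM /(real_two_form hw skM) /(real_skew_Jtau skM) [Q [QH ->]].
have [E [nu [EU EQ]]] := hyperherm_spectral QH.
exists E, nu; split=> //.
by rewrite normal_mxE -EQ !tauM !mulmxA tau_tr_Jmx.
Qed.

Lemma two_form_normal (E : 'M[H]_n) (nu : 'rV[R]_n) M : unitaryq E ->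
  (tau E)^T *m M *m tau E = normal_mx nu ->
  two_form w M = 2 *: \sum_l (nu 0 l)%:C *: pull_form w (row l (adjq E)).
Proof. by move=> EU /(normal_mxP EU)->; rewrite diag_sum -two_form_pull. Qed.

Lemma row_unitary_neq0 (E : 'M[H]_n) l : unitaryq E -> row l (adjq E) != 0.
Proof.
case=> E1 _; apply/eqP => El0; have /rowP/(_ l) : row l (adjq E *m E) = 0.
  by rewrite row_mul El0 mul0mx.
by rewrite E1 !mxE eqxx => /eqP; rewrite oner_eq0.
Qed.

Lemma strongly_positive_normal (E : 'M[H]_n) (nu : 'rV[R]_n) M :
  M^T = - M -> unitaryq E -> (tau E)^T *m M *m tau E = normal_mx nu ->
  strongly_positive w (two_form w M) ->
  (forall l, 0 <= nu 0 l) /\ (exists l, 0 < nu 0 l).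
Proof.
move=> skM EU EM [_ [m [c [psi [c0 psiE ME]]]]]; have [E1 E2] := EU.
have [N NE] : exists N : 'I_m.+1 -> 'rV[H]_n,
    forall i, N i != 0 /\ psi i = pull_form w (N i).
  apply: (@fin_all_exists _ _ (fun i N => N != 0 /\ psi i = pull_form w N)) => i.
  have [_ [eta [N [_ etaE [q etaq] ->]]]] := psiE i.
  exists N; split=> //; apply/eqP => N0; apply: etaq.
  by rewrite etaE N0 big1 // => l _; rewrite mxE mul0r.
(* The Gram matrix of the given decomposition. Matching 2M = J tau(G) with the normal form gives 2 E
   D E^* = G, D being the diagonal matrix of the nu_l. *)
pose G := \sum_i realq (c i) *: (adjq (N i) *m N i).
have GH : adjq G = G.
  rewrite raddf_sum; apply: eq_bigr => i _.
  by rewrite /= adjq_realZ adjq_mul adjqK.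
have ME' : 2 *: M = J *m tau G.
  apply: (two_form_inj hw); [by rewrite linearZ /= skM scalerN | exact: skew_Jtau |].
  rewrite -two_form_pull linearZ /= ME; congr (_ *: _); apply: eq_bigr => i _.
  by have [_ ->] := NE i.
have GE : realq 2 *: (E *m diag_mx (map_mx (@realq R) nu) *m adjq E) = G.
  apply/tau_inj/Jmx_cancel; rewrite -ME' tau_realZ -scalemxAr -(normal_mxP EU EM).
  by rewrite (rmorph_nat (real_complex R)).
have nuE : realq 2 *: diag_mx (map_mx (@realq R) nu) =
    \sum_i realq (c i) *: (adjq (N i *m E) *m (N i *m E)).
  have -> : \sum_i realq (c i) *: (adjq (N i *m E) *m (N i *m E)) = adjq E *m G *m E.
    rewrite mulmx_sumr mulmx_suml; apply: eq_bigr => i _.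
    by rewrite mulmx_realZ -scalemxAl adjq_mul !mulmxA.
  rewrite -GE mulmx_realZ -scalemxAl; congr (_ *: _).
  by rewrite !mulmxA E1 mul1mx -mulmxA E1 mulmx1.
(* The diagonal entries of 2 D = E^* G E. *)
have nu_sum l : 2 * nu 0 l = \sum_i c i * sqnormq ((N i *m E) 0 l).
  have /matrixP/(_ l l) := nuE; rewrite summxE !mxE eqxx mulr1n -rmorphM /=.
  move=> /(congr1 (@q0 R)) /= ->.
  have -> : \sum_i (realq (c i) *: (adjq (N i *m E) *m (N i *m E))) l l =
      realq (\sum_i c i * sqnormq ((N i *m E) 0 l)).
    rewrite raddf_sum; apply: eq_bigr => i _.
    rewrite /= rmorphM /= -conjq_mul [LHS]mxE [(_ *m _) l l]mxE big_ord1.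
    by rewrite [adjq _ _ _]mxE [map_mx _ _ _ _]mxE.
  by [].
have term_ge0 l i : 0 <= c i * sqnormq ((N i *m E) 0 l).
  by rewrite mulr_ge0 ?sqnormq_ge0 // ltW.
have nu_ge0 l : 0 <= nu 0 l.
  by rewrite -(pmulr_rge0 _ (ltr0Sn R 1)) nu_sum sumr_ge0.
split=> //.
(* A positive nu_l exists because N_0 is nonzero and E is invertible, so N_0 E has a nonzero entry,
   and c_0 > 0. *)
have [l Pl] : exists l, (N ord0 *m E) 0 l != 0.
  have [N0 _] := NE ord0.
  apply/existsP; apply: contraR N0 => /existsPn h.
  rewrite -[N ord0]mulmx1 -E2 mulmxA (_ : N ord0 *m E = 0) ?mul0mx //.
  by apply/rowP => l; rewrite [RHS]mxE; apply/eqP; have := h l; rewrite negbK.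
exists l; rewrite lt_neqAle nu_ge0 andbT eq_sym.
apply: contra Pl => /eqP nul0; have := nu_sum l; rewrite nul0 mulr0 => /esym/eqP.
rewrite psumr_eq0 // => /allP/(_ ord0 (mem_index_enum _)) /=.
by rewrite mulf_eq0 gt_eqF //= sqnormq_eq0.
Qed.

Lemma normal_strongly_positive (E : 'M[H]_n) (nu : 'rV[R]_n) M :
  real_form w 1 (two_form w M) -> unitaryq E ->
  (tau E)^T *m M *m tau E = normal_mx nu ->
  (forall l, 0 <= nu 0 l) -> (exists l, 0 < nu 0 l) ->
  strongly_positive w (two_form w M).
Proof.
move=> rM EU EM nu0 [l0 nul0].
(* Coefficients must be positive, so only the l with nu_l > 0 are kept; the dropped terms are zero.
   The 2 of the normal form is absorbed into c. *)
apply: (strongly_positive_sum hw (P := [pred l | 0 < nu 0 l])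
          (c := fun l => 2 * nu 0 l) (N := fun l => row l (adjq E))) => //.
- by exists l0.
- by move=> l /= nul; rewrite mulr_gt0.
- by move=> l _; apply: row_unitary_neq0.
rewrite (two_form_normal EU EM) scaler_sumr [RHS]big_mkcond; apply: eq_bigr => l _ /=.
case: ifP => [_|nul]; first by rewrite scalerA rmorphM rmorph_nat.
have -> : nu 0 l = 0 by apply/eqP; rewrite eq_le nu0 andbT leNgt nul.
by rewrite rmorph0 scale0r scaler0.
Qed.

End Normalization.

Theorem theorem1p1 (R : realType) (n : nat) (hn : (1 <= n)%N)
    (w : (n + n).-tuple 'rV[R[i]]_(n + n)) (hw : basis_of fullv w) :
  (forall M : 'M[R[i]]_(n + n), M^T = - M ->
     (real_form w 1 (two_form w M) <->
      exists Q : 'M[quat R]_n, hyperhermitian Q /\ M = tau Q *m Jmx R n)) /\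
  (forall M : 'M[R[i]]_(n + n), M^T = - M -> real_form w 1 (two_form w M) ->
     (exists (E : 'M[quat R]_n) (nu : 'rV[R]_n),
        unitaryq E /\ (tau E)^T *m M *m tau E = normal_mx nu) /\
     (forall (E : 'M[quat R]_n) (nu : 'rV[R]_n),
        unitaryq E -> (tau E)^T *m M *m tau E = normal_mx nu ->
        two_form w M =
          2 *: \sum_(l < n) (nu 0 l)%:C *:
            wedge (ext1 (actq w (adjq E) (tnth w (lshift n l))))
                  (ext1 (actq w (adjq E) (tnth w (rshift n l)))) /\
        (strongly_positive w (two_form w M) <->
         (forall l : 'I_n, 0 <= nu 0 l) /\ (exists l : 'I_n, 0 < nu 0 l)))).
Proof.
split=> [M skM | M skM rM].
  split=> [/(real_two_form hw skM) /(real_skew_tauJ skM) [Q [QH ->]] | [Q [_ ME]]].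
    by exists Q; split=> //; apply/hyperhermitianE.
  by apply/(real_two_form hw skM); rewrite ME real_tauJ.
split; first exact: (exists_normal_form hw).
move=> E nu EU EM; split.
  rewrite (two_form_normal w EU EM); apply: (congr1 (GRing.scale 2)).
  apply: eq_bigr => l _.
  by rewrite (actq_lshift hw) (actq_rshift hw).
split=> [|[nu0 nupos]]; first exact: (strongly_positive_normal hw skM EU EM).
exact: (normal_strongly_positive hw rM EU EM).
Qed.
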